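(* Let $X$ be a real or complex inner product space. A metric subspace $Z$ of $X$ has strict $2$-negative type if and only if it does not admit any non-degenerate balanced simplices.
   Context: $X$ carries the metric $d(x,y)=\|x-y\|$ induced by the inner product norm. A metric space $(Z,d)$ has $2$-negative type if for all finite sets of distinct points $\{z_1,\ldots,z_n\}\subseteq Z$ and all real $\alpha_1,\ldots,\alpha_n$ with $\alpha_1+\cdots+\alpha_n=0$ we have $\sum_{j,i=1}^n d(z_j,z_i)^2\alpha_j\alpha_i\le 0$; it has strict $2$-negative type if moreover this inequality is strict unless $\alpha_1=\cdots=\alpha_n=0$. A signed $(s,t)$-simplex in a set $Z$ ($s,t>0$ integers) is a collection of (not necessarily distinct) points $x_{1},\ldots,x_{s},y_{1},\ldots,y_{t}\in Z$ together with real numbers $m_{1},\ldots,m_{s},n_{1},\ldots,n_{t}$ satisfying $m_{1}+\cdots+m_{s}=n_{1}+\cdots+n_{t}$; it is denoted $D=[x_{j}(m_{j});y_{i}(n_{i})]_{s,t}$. Let $S(D)=\{x_1,\ldots,x_s\}\cup\{y_1,\ldots,y_t\}$. For $z\in S(D)$ put $\mathbf{m}(z)=\sum_{j:x_j=z}m_j$ and $\mathbf{n}(z)=\sum_{i:y_i=z}n_i$ (empty sums are $0$). $D$ is degenerate if $\mathbf{m}(z)=\mathbf{n}(z)$ for all $z\in S(D)$. A simplex $D$ whose points lie in a vector space is balanced if $\sum_j m_jx_j=\sum_i n_iy_i$. $Z$ admits a simplex if there is such a simplex all of whose points lie in $Z$. *)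

(* Defs.v *)
From HB Require Import structures.
From mathcomp Require Import all_boot all_order all_algebra.
From mathcomp Require Import sesquilinear.
From mathcomp Require Import complex.
From mathcomp Require Import classical_sets reals.

Set Implicit Arguments.
Unset Strict Implicit.
Unset Printing Implicit Defensive.
Import Order.TTheory GRing.Theory Num.Theory.

Local Open Scope ring_scope.
Local Open Scope classical_set_scope.

(* The metric subspace (Z, d) of a metric space T is represented by the subset
   Z of T together with the distance d of the ambient space.  A set of n
   distinct points is given by an injective family indexed by 'I_n. *)
Definition two_negative_type (R : realType) (T : Type) (d : T -> T -> R)
    (Z : set T) : Prop :=
  forall (n : nat) (z : 'I_n -> T) (alpha : 'I_n -> R),
    injective z -> (forall i, Z (z i)) -> \sum_(i < n) alpha i = 0 ->
    \sum_(j < n) \sum_(i < n) d (z j) (z i) ^+ 2 * alpha j * alpha i <= 0.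

Definition strict_two_negative_type (R : realType) (T : Type)
    (d : T -> T -> R) (Z : set T) : Prop :=
  two_negative_type d Z /\
  forall (n : nat) (z : 'I_n -> T) (alpha : 'I_n -> R),
    injective z -> (forall i, Z (z i)) -> \sum_(i < n) alpha i = 0 ->
    ~ (forall i, alpha i = 0) ->
    \sum_(j < n) \sum_(i < n) d (z j) (z i) ^+ 2 * alpha j * alpha i < 0.

Record signed_simplex (R : realType) (T : Type) (s t : nat) := SignedSimplex {
  left_points : 'I_s -> T;
  right_points : 'I_t -> T;
  left_weights : 'I_s -> R;
  right_weights : 'I_t -> R;
  left_size_gt0 : (0 < s)%N;
  right_size_gt0 : (0 < t)%N;
  weights_eq : \sum_(j < s) left_weights j = \sum_(i < t) right_weights i
}.

Definition simplex_points (R : realType) (T : Type) (s t : nat)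
    (D : signed_simplex R T s t) : set T :=
  range (left_points D) `|` range (right_points D).

Definition left_mass (R : realType) (T : eqType) (s t : nat)
    (D : signed_simplex R T s t) (z : T) : R :=
  \sum_(j < s | left_points D j == z) left_weights D j.

Definition right_mass (R : realType) (T : eqType) (s t : nat)
    (D : signed_simplex R T s t) (z : T) : R :=
  \sum_(i < t | right_points D i == z) right_weights D i.

Definition degenerate (R : realType) (T : eqType) (s t : nat)
    (D : signed_simplex R T s t) : Prop :=
  forall z, simplex_points D z -> left_mass D z = right_mass D z.

(* The weights are always real; [inj] embeds them in the scalar field K of the
   vector space (the identity for K = R, real_complex R for K = R[i]). *)
Definition balanced (R : realType) (K : nzRingType) (inj : R -> K)
    (X : lmodType K) (s t : nat) (D : signed_simplex R X s t) : Prop :=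
  \sum_(j < s) inj (left_weights D j) *: left_points D j =
  \sum_(i < t) inj (right_weights D i) *: right_points D i.

Definition admits (R : realType) (T : Type) (Z : set T)
    (P : forall s t : nat, signed_simplex R T s t -> Prop) : Prop :=
  exists (s t : nat) (D : signed_simplex R T s t),
    simplex_points D `<=` Z /\ P s t D.

(* ||x - y|| for the norm ||u|| = sqrt <u, u>.  For complex scalars <u, u> is a
   complex number with zero imaginary part, which [re] converts to R. *)
Definition inner_dist (R : realType) (K : nzRingType) (re : K -> R)
    (X : lmodType K) (dot : X -> X -> K) (x y : X) : R :=
  Num.sqrt (re (dot (x - y) (x - y))).

(* Main.v *)
(** If the weights [alpha] sum to zero and [w] is the vector sum of the
    [alpha i *: z i], then expanding the squared distances shows that the
    quadratic sum of [d (z j) (z i) ^+ 2 * alpha j * alpha i] equals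
    [- 2 * |w|^2].  So 2-negative type always holds, and strictness fails
    exactly when some nonzero weights of sum zero give [w = 0].  Such weights
    are the differences [left_mass - right_mass] of a non-degenerate balanced
    simplex. *)
Require Import Defs.
From mathcomp Require Import all_boot all_order all_algebra.
From mathcomp Require Import sesquilinear complex classical_sets reals.
From mathcomp Require Import ring.
Set Implicit Arguments.
Unset Strict Implicit.
Unset Printing Implicit Defensive.
Import Order.TTheory GRing.Theory Num.Theory.
Local Open Scope ring_scope.

(** Injectivity of [z] makes the fibres of [x] disjoint, and the covering hypothesis makes them
    exhaust all indices. This turns sums of masses over distinct points into sums over the indices
    of a simplex. *)
Lemma sum_fibers (V : nmodType) (T : eqType) (n s : nat) (z : 'I_n -> T)
    (x : 'I_s -> T) (F : 'I_s -> V) :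
    injective z -> (forall j, exists i, z i = x j) ->
  \sum_(i < n) \sum_(j < s | x j == z i) F j = \sum_(j < s) F j.
Proof.
move=> zI xz; rewrite (exchange_big_dep predT) //=; apply: eq_bigr => j _.
have [i zi] := xz j; rewrite (big_pred1 i) // => k.
by rewrite -zi (inj_eq zI) eq_sym.
Qed.

(** Both scalar fields are treated at once: [q] stands for the real part of the inner product, which
    is symmetric and real-bilinear even when the product itself is only Hermitian. *)
Section RealInnerProduct.
Variables (R : realType) (K : nzRingType) (inj : {rmorphism R -> K}).
Variables (X : lmodType K) (q : X -> X -> R) (d : X -> X -> R).
Hypothesis qDl : forall u v w, q (u + v) w = q u w + q v w.
Hypothesis qZl : forall a u v, q (inj a *: u) v = a * q u v.
Hypothesis qC : forall u v, q u v = q v u.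
Hypothesis q_gt0 : forall u, u != 0 -> 0 < q u u.
Hypothesis dE : forall x y, d x y ^+ 2 = q (x - y) (x - y).

Let vsum n (a : 'I_n -> R) (z : 'I_n -> X) := \sum_(i < n) inj (a i) *: z i.

Let q0l v : q 0 v = 0.
Proof. by rewrite -[0 in LHS](scale0r 0) -(rmorph0 inj) qZl mul0r. Qed.

Let qBB u v : q (u - v) (u - v) = q u u + q v v - 2 * q u v.
Proof.
have qBl x y w : q (x - y) w = q x w - q y w.
  by rewrite qDl -[- y]scaleN1r -(rmorphN1 inj) qZl mulN1r.
by rewrite qBl !(qC _ (u - v)) !qBl (qC v u); ring.
Qed.

Lemma form_vsuml n (a : 'I_n -> R) (z : 'I_n -> X) v :
  q (vsum a z) v = \sum_(i < n) a i * q (z i) v.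
Proof.
rewrite /vsum (big_morph (q^~ v) (fun x y => qDl x y v) (q0l v)).
by apply: eq_bigr => i _; rewrite qZl.
Qed.

Lemma sum_dist_sqr n (z : 'I_n -> X) (a : 'I_n -> R) :
    \sum_(i < n) a i = 0 ->
  \sum_(j < n) \sum_(i < n) d (z j) (z i) ^+ 2 * a j * a i =
    - (2 * q (vsum a z) (vsum a z)).
Proof.
move=> a0.
(* Summing over [i] kills the terms [q (z j) (z j)]; the terms [q (z i) (z i)] vanish only later, in
   the sum over [j]. *)
have split_sum j : \sum_(i < n) d (z j) (z i) ^+ 2 * a j * a i =
    a j * \sum_(i < n) a i * q (z i) (z i) -
    2 * (a j * q (z j) (vsum a z)).
  transitivity (\sum_(i < n) (q (z j) (z j) * a j * a i +
      (a j * (a i * q (z i) (z i)) - 2 * (a j * (a i * q (z i) (z j)))))).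
    by apply: eq_bigr => i _; rewrite dE qBB (qC (z j)); ring.
  rewrite big_split /= -mulr_sumr a0 mulr0 add0r sumrB -!mulr_sumr.
  by rewrite (qC (z j)) form_vsuml.
rewrite (eq_bigr _ (fun j _ => split_sum j)) sumrB -mulr_suml a0 mul0r sub0r.
by rewrite -mulr_sumr -form_vsuml.
Qed.

Lemma strict_two_negative_typeP (Z : set X) :
  strict_two_negative_type d Z <->
  ~ admits Z (fun (s t : nat) (D : signed_simplex R X s t) =>
                ~ degenerate D /\ balanced inj D).
Proof.
split=> [[_ strictZ] [s [t [D [DZ [Dnd Dbal]]]]]|noD].
  (* Points of a simplex may repeat, so duplicates are removed to get an injective family. The
     default [0] of [nth] is never reached. *)
  pose p := undup (codom (left_points D) ++ codom (right_points D)).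
  pose z (i : 'I_(size p)) := nth 0 p i.
  have zI : injective z.
    move=> i j /eqP; rewrite nth_uniq ?undup_uniq // => /eqP; exact: val_inj.
  have zP x : x \in p -> exists i, z i = x.
    by rewrite -index_mem => xp; exists (Ordinal xp); rewrite /z nth_index -?index_mem.
  have lz j : exists i, z i = left_points D j.
    by apply: zP; rewrite mem_undup mem_cat codom_f.
  have rz j : exists i, z i = right_points D j.
    by apply: zP; rewrite mem_undup mem_cat codom_f orbT.
  have zS i : simplex_points D (z i).
    have: z i \in p by exact: mem_nth.
    rewrite mem_undup mem_cat => /orP[]/codomP[j ->].
    - by left; exists j.
    - by right; exists j.
  pose a i := left_mass D (z i) - right_mass D (z i).
  have a0 : \sum_(i < size p) a i = 0.
    by rewrite sumrB !sum_fibers // weights_eq subrr.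
  have w0 : vsum a z = 0.
    rewrite /vsum; under eq_bigr do rewrite rmorphB scalerBl.
    (* On the fibre over [z i] every point equals [z i], so regrouping the fibres recovers the two
       sides of the balance equation. *)
    have fiberE m (x : 'I_m -> X) (c : 'I_m -> R) i :
        inj (\sum_(j < m | x j == z i) c j) *: z i =
        \sum_(j < m | x j == z i) inj (c j) *: x j.
      by rewrite rmorph_sum scaler_suml; apply: eq_bigr => j /eqP ->.
    rewrite sumrB; under eq_bigr do rewrite fiberE.
    under [X in _ - X]eq_bigr do rewrite fiberE.
    by rewrite !sum_fibers //; apply/eqP; rewrite subr_eq0; apply/eqP.
  (* Since the quadratic sum is zero, strictness would give [0 < 0] unless all [a i] vanish, which
     makes [D] degenerate. *)
  have := strictZ _ z a zI (fun i => DZ _ (zS i)) a0.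
  rewrite sum_dist_sqr // w0 q0l mulr0 oppr0 ltxx => contra.
  apply/notF/contra => aall0; apply: Dnd => x.
  case=> -[j _ <-]; [have [i <-] := lz j | have [i <-] := rz j];
    by apply/eqP; rewrite -subr_eq0; apply/eqP/aall0.
have q_ge0 u : 0 <= q u u.
  by have [->|/q_gt0/ltW//] := eqVneq u 0; rewrite q0l.
split=> n z a zI zZ a0.
  by rewrite sum_dist_sqr // oppr_le0 mulr_ge0.
move=> a_neq0; rewrite sum_dist_sqr // oppr_lt0 mulr_gt0 // q_gt0 //.
apply/eqP => w0; apply: noD.
(* For [n = 0] all weights would vanish vacuously. *)
have n_gt0 : (0 < n)%N.
  by case: n z a zI zZ a0 a_neq0 w0 => // z a _ _ _ [] [].
have weights0 : \sum_(i < n) a i = \sum_(i < n) 0 by rewrite a0 big1.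
(* The same points serve on both sides, with weights [a] on the left and zero on the right: the mass
   difference at [z i] is [a i], and balance reads [vsum a z = 0]. *)
exists n, n, (SignedSimplex z z n_gt0 n_gt0 weights0).
split=> [x|]; first by case=> -[i _ <-].
split=> [deg|].
  apply: a_neq0 => i; have /deg : simplex_points
    (SignedSimplex z z n_gt0 n_gt0 weights0) (z i) by left; exists i.
  rewrite /left_mass /right_mass /= (big_pred1 i); last first.
    by move=> j; rewrite (inj_eq zI).
  by rewrite big1.
rewrite /balanced /=; rewrite -/(vsum a z) w0 big1 // => i _.
by rewrite rmorph0 scale0r.
Qed.

End RealInnerProduct.

Theorem corollary5p3 (R : realType) :
  (forall (X : lmodType R) (dot : {dot X for idfun}) (Z : set X),
      strict_two_negative_type (inner_dist idfun dot) Z <->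
      ~ admits Z (fun (s t : nat) (D : signed_simplex R X s t) =>
                    ~ degenerate D /\ balanced idfun D))
  /\
  (forall (X : lmodType (complex R)) (dot : {dot X for @conjc R}) (Z : set X),
      strict_two_negative_type (inner_dist (@complex.Re R) dot) Z <->
      ~ admits Z (fun (s t : nat) (D : signed_simplex R X s t) =>
                    ~ degenerate D /\ balanced (real_complex R) D)).
Proof.
split=> X dot Z.
- have dot_gt0 u : u != 0 -> 0 < dot u u by exact: neq0_dnorm_gt0.
  apply: (@strict_two_negative_typeP R R idfun X (fun u v => dot u v)) => //.
  + by move=> u v w; rewrite linearDl.
  + by move=> a u v; rewrite linearZl_LR.
  + by move=> u v; rewrite hermC /= expr0 mul1r.
  + move=> x y; rewrite /inner_dist sqr_sqrtr //=.
    by have [->|/dot_gt0/ltW//] := eqVneq (x - y) 0; rewrite linear0l.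
(* Positivity in the order on complex numbers means zero imaginary part and positive real part. *)
- have dot_gt0 u : u != 0 -> 0 < complex.Re (dot u u).
    by move=> /(neq0_dnorm_gt0 (s := dot)); rewrite ltcE => /andP[].
  apply: (@strict_two_negative_typeP R (complex R) (real_complex R) X
            (fun u v => complex.Re (dot u v))) => //.
  + by move=> u v w; rewrite linearDl raddfD.
  + by move=> a u v; rewrite linearZl_LR /=; case: (dot u v) => b c /=; ring.
  (* Swapping the arguments conjugates the value, which keeps its real part. *)
  + by move=> u v; rewrite hermC /= expr0 mul1r; case: (dot v u).
  + move=> x y; rewrite /inner_dist sqr_sqrtr //=.
    by have [->|/dot_gt0/ltW//] := eqVneq (x - y) 0; rewrite linear0l.
Qed.
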